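(* Let $m\ge1$ be an integer, $\mu>0$, let $D\subset\mathbb{R}^2$ be a compact convex domain, and let $V_1,\dots,V_N\in D$ be distinct nodes with radii of influence $R_{w_i}$ and associated triangles $\Delta_2(i)$. The degree of exactness of the bivariate Shepard-Bernoulli operator $S_{B_m}$ is $m$, i.e. $S_{B_m}[p]=p$ on $D$ for each bivariate polynomial $p$ of total degree at most $m$.
   Context: Weights. For each $i$ let $R_{w_i}>0$ and $B(V_i,R_{w_i})=\{\boldsymbol{x}\in\mathbb{R}^2:|\boldsymbol{x}-V_i|<R_{w_i}\}$; the balls are assumed to cover $D$. Put $W_{\mu,i}(\boldsymbol{x})=\left(\frac{1}{|\boldsymbol{x}-V_i|}-\frac{1}{R_{w_i}}\right)_+^{\mu}$, where $(\cdot)_+$ is the positive part, and $\widetilde W_{\mu,i}(\boldsymbol{x})=W_{\mu,i}(\boldsymbol{x})/\sum_{k=1}^N W_{\mu,k}(\boldsymbol{x})$, extended by continuity to the nodes, i.e. $\widetilde W_{\mu,i}(V_k)=\delta_{ik}$. Triangles. To each node $V_i$ is associated a non-degenerate triangle $\Delta_2(i)\subset B(V_i,R_{w_i})$ with vertices $V_i,V_{j_i},V_{k_i}$ among the nodes (assumed to exist), chosen to minimize $r_i(r_i^2S_i)$ among such triangles, where $r_i$ is the length of the longest side and $S_i$ is the reciprocal of twice the area of the triangle; ties are broken by a fixed enumeration. Generalized Taylor polynomial. For a non-degenerate triangle with vertices $U_1,U_2,U_3\in D$, let $A(P,Q,R)$ be the determinant of the $3\times3$ matrix with columns $(1,P)^T,(1,Q)^T,(1,R)^T$,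 $\lambda_2=\frac{A(U_1,\boldsymbol{x},U_3)}{A(U_1,U_2,U_3)}$, $\lambda_3=\frac{A(U_1,U_2,\boldsymbol{x})}{A(U_1,U_2,U_3)}$, $D_{ij}f=(U_i-U_j)\cdot\nabla f$, and $D_1^\beta=D_{21}^{\beta_1}D_{31}^{\beta_2}$, $D_2^\beta=D_{12}^{\beta_1}D_{32}^{\beta_2}$, $D_3^\beta=D_{13}^{\beta_1}D_{23}^{\beta_2}$. Bernoulli polynomials: $B_0(x)=1$, $B_n'(x)=nB_{n-1}(x)$, $\int_0^1B_n=0$ for $n\ge1$; $S_k(x)=B_k(x)-B_k(0)$. Then $$\begin{aligned}P_{m}^{[\Delta_2(U_1,U_2,U_3);U_1]}[f](\boldsymbol{x})=&f(U_1)+\sum_{j=1}^{m}\left(D_1^{(0,j-1)}f(U_3)-D_1^{(0,j-1)}f(U_1)\right)\frac{S_j(\lambda_2+\lambda_3)}{j!}\\&+\sum_{i=1}^{m}\sum_{j=1}^{m-i+1}\Big((-1)^{i+j}\big(D_2^{(j-1,i-1)}f(U_2)-D_2^{(j-1,i-1)}f(U_1)\big)\\&\quad+(-1)^j\big(D_3^{(j-1,i-1)}f(U_3)-D_3^{(j-1,i-1)}f(U_1)\big)\Big)\frac{(\lambda_2+\lambda_3)^{i-1}S_i\left(\frac{\lambda_2}{\lambda_2+\lambda_3}\right)}{i!}\frac{S_j(\lambda_2+\lambda_3)}{j!},\end{aligned}$$ where the products $(\lambda_2+\lambda_3)^{i-1}S_i\left(\frac{\lambda_2}{\lambda_2+\lambda_3}\right)S_j(\lambda_2+\lambda_3)$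 are understood as polynomials in $\lambda_2,\lambda_3$ also where $\lambda_2+\lambda_3=0$. Write $P_m^{\Delta_2(i)}=P_m^{[\Delta_2(V_i,V_{j_i},V_{k_i});V_i]}$. The bivariate Shepard-Bernoulli operator is $S_{B_m}[f](\boldsymbol{x})=\sum_{i=1}^N\widetilde W_{\mu,i}(\boldsymbol{x})P_m^{\Delta_2(i)}[f](\boldsymbol{x})$, $\boldsymbol{x}\in D$. ''Degree of exactness $m$'' is used in the sense spelled out after ''i.e.'' in the claim. *)

(* Defs.v *)
(* The notations of [mpoly] clash with those of the analysis library, so only
   its structure instances and constants are imported. *)
From HB Require Import structures.
From mathcomp Require Import all_boot all_order all_algebra.
From mathcomp Require Import -(notations) mpoly.
From mathcomp Require Import all_classical all_reals all_analysis.

Set Implicit Arguments.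
Unset Strict Implicit.
Unset Printing Implicit Defensive.
Import Order.TTheory GRing.Theory Num.Theory.
Import numFieldNormedType.Exports.
Local Open Scope classical_set_scope.
Local Open Scope ring_scope.

Section Plane.
Context {R : realType}.
Implicit Types (P Q S x u v : 'rV[R]_2) (f : 'rV[R]_2 -> R).

Definition dot u v : R := \sum_(k < 2) u 0 k * v 0 k.

(* The library norm on 'rV[R]_2 is the sup norm; distances here are Euclidean.
   The two norms induce the same topology. *)
Definition enorm x : R := Num.sqrt (dot x x).

Definition eball (c : 'rV[R]_2) (r : R) : set 'rV[R]_2 :=
  [set x | enorm (x - c) < r].

Definition grad f x : 'rV[R]_2 := \row_(k < 2) 'D_(delta_mx 0 k) f x.

Definition Dseg P Q f : 'rV[R]_2 -> R := fun x => dot (P - Q) (grad f x).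

Definition detA P Q S : R :=
  \det (row_mx (col_mx (1%:M : 'M[R]_1) P^T)
               (row_mx (col_mx (1%:M : 'M[R]_1) Q^T) (col_mx (1%:M : 'M[R]_1) S^T))
        : 'M[R]_3).

Definition triangle P Q S : set 'rV[R]_2 :=
  [set x | exists a b c : R,
     [/\ 0 <= a, 0 <= b, 0 <= c, a + b + c = 1 &
         x = a *: P + b *: Q + c *: S]].

Definition nondegenerate P Q S : bool := detA P Q S != 0.

Definition area P Q S : R := `|detA P Q S| / 2.

Definition longest_side P Q S : R :=
  Num.max (enorm (P - Q)) (Num.max (enorm (Q - S)) (enorm (S - P))).

Definition triangle_cost P Q S : R :=
  let r := longest_side P Q S in r * (r ^+ 2 * (2 * area P Q S)^-1).

End Plane.

Section Bernoulli.
Context {R : realType}.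
Implicit Types p : {poly R}.

(* The antiderivative vanishing at 0: its constant coefficient is p`_0 / 0 = 0. *)
Definition antideriv p : {poly R} :=
  \poly_(i < (size p).+1) (p`_i.-1 / i%:R).

(* The constant of integration makes the integral over [0, 1] vanish; see
   [deriv_bernpoly] and [integral_bernpoly]. *)
Fixpoint bernpoly (n : nat) : {poly R} :=
  if n is k.+1 then
    let q := n%:R *: antideriv (bernpoly k) in q - (antideriv q).[1]%:P
  else 1.

Definition bernS (k : nat) : {poly R} := bernpoly k - (bernpoly k).[0]%:P.

(* The polynomial in s and t equal to s^(i-1) S_i(t/s) S_j(s) for s != 0
   (see [bernSSE]): the coefficient of S_i in degree k contributes
   t^k s^(i-k) (S_j(s)/s), and S_j is divisible by 'X. *)
Definition bernSS (i j : nat) (t s : R) : R :=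
  (\sum_(k < i.+1) (bernS i)`_k * t ^+ k * s ^+ (i - k))
  * (drop_poly 1 (bernS j)).[s].

Lemma bernpoly0 : bernpoly 0 = 1.
Proof. by []. Qed.

Lemma coef_antideriv p i : (antideriv p)`_i = p`_i.-1 / i%:R.
Proof.
rewrite coef_poly; case: ltnP => //; case: i => [|i] //= pi.
by rewrite nth_default ?mul0r.
Qed.

Lemma antiderivK p : (antideriv p)^`() = p.
Proof.
apply/polyP => i; rewrite coef_deriv coef_antideriv /=.
by rewrite -(mulr_natr (_ / _)) divfK ?pnatr_eq0.
Qed.

Lemma antideriv_horner0 p : (antideriv p).[0] = 0.
Proof. by rewrite horner_coef0 coef_antideriv invr0 mulr0. Qed.

Lemma antiderivBC p (c : R) : antideriv (p - c%:P) = antideriv p - c *: 'X.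
Proof.
apply/polyP => -[|[|i]]; rewrite !(coefB, coefZ, coefX, coef_antideriv) !coefC/=.
- by rewrite invr0 !mulr0 subr0.
- by rewrite divr1 mulr1 invr1 mulr1.
- by rewrite mulr0 !subr0.
Qed.

Lemma deriv_bernpoly n : (bernpoly n.+1)^`() = n.+1%:R *: bernpoly n.
Proof. by rewrite /= derivB derivC subr0 derivZ antiderivK. Qed.

Lemma is_derive_antideriv p (x : R) :
  is_derive x 1 (horner (antideriv p)) p.[x].
Proof. by have := is_derive_poly (antideriv p) x; rewrite antiderivK. Qed.

Lemma integral_poly01 p :
  (\int[lebesgue_measure]_(x in `[0%R, 1%R]) (p.[x])%:E
   = ((antideriv p).[1])%:E)%E.
Proof.
have cp (q : {poly R}) : continuous (horner q) by exact: continuous_horner.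
rewrite (@continuous_FTC2 _ (horner p) (horner (antideriv p))) ?ltr01//.
- by rewrite antideriv_horner0 sube0.
- by apply: continuous_subspaceT; exact: cp.
- split.
  + by move=> x _; have [] := is_derive_antideriv p x.
  + by apply: cvg_at_right_filter; exact: cp.
  + by apply: cvg_at_left_filter; exact: cp.
- move=> x _; rewrite derive1E.
  exact: (@derive_val _ _ _ _ _ _ _ (is_derive_antideriv p x)).
Qed.

Lemma integral_bernpoly n :
  (\int[lebesgue_measure]_(x in `[0%R, 1%R]) ((bernpoly n.+1).[x])%:E = 0)%E.
Proof.
by rewrite integral_poly01 /= antiderivBC !hornerE subrr.
Qed.

Lemma size_antideriv p : (size (antideriv p) <= (size p).+1)%N.
Proof. exact: size_poly. Qed.

Lemma size_bernpoly n : (size (bernpoly n) <= n.+1)%N.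
Proof.
elim: n => [|n IHn] /=; first by rewrite size_poly1.
rewrite (leq_trans (size_polyD _ _))// geq_max size_polyN.
rewrite (leq_trans (size_polyC_leq1 _))// andbT.
by rewrite (leq_trans (size_scale_leq _ _))// (leq_trans (size_antideriv _)).
Qed.

Lemma bernSSE (i j : nat) (t s : R) : (0 < i)%N -> s != 0 ->
  bernSS i j t s = s ^+ i.-1 * (bernS i).[t / s] * (bernS j).[s].
Proof.
case: i => // i _ s0 /=; rewrite /bernSS.
have -> : (bernS j).[s] = (drop_poly 1 (bernS j)).[s] * s.
  rewrite -{1}(poly_take_drop 1 (bernS j)) hornerD hornerM hornerX.
  suff -> : take_poly 1 (bernS j) = 0 by rewrite horner0 add0r.
  apply/polyP => -[|k]; rewrite coef_take_poly coef0//= /bernS coefB coefC/=.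
  by rewrite horner_coef0 subrr.
have si : (size (bernS i.+1) <= i.+2)%N.
  rewrite (leq_trans (size_polyD _ _))// geq_max size_bernpoly size_polyN.
  exact: leq_trans (size_polyC_leq1 _) _.
rewrite (horner_coef_wide _ si) [_ * s]mulrC mulrA; congr (_ * _).
rewrite mulrAC -exprSr mulr_sumr; apply: eq_bigr => k _.
have ki : (k <= i.+1)%N by rewrite -ltnS.
rewrite expr_div_n expfB_cond ?(negbTE s0)//.
by rewrite [RHS]mulrCA -mulrA; congr (_ * _); rewrite mulrCA.
Qed.

End Bernoulli.

Section Taylor.
Context {R : realType}.
Variables (m : nat) (U1 U2 U3 : 'rV[R]_2) (f : 'rV[R]_2 -> R).
Implicit Types x : 'rV[R]_2.

Definition lambda2 x : R := detA U1 x U3 / detA U1 U2 U3.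
Definition lambda3 x : R := detA U1 U2 x / detA U1 U2 U3.

Definition D1 (a b : nat) : 'rV[R]_2 -> R :=
  iter a (Dseg U2 U1) (iter b (Dseg U3 U1) f).
Definition D2 (a b : nat) : 'rV[R]_2 -> R :=
  iter a (Dseg U1 U2) (iter b (Dseg U3 U2) f).
Definition D3 (a b : nat) : 'rV[R]_2 -> R :=
  iter a (Dseg U1 U3) (iter b (Dseg U2 U3) f).

Definition gen_taylor x : R :=
  let s := lambda2 x + lambda3 x in
  f U1
  + \sum_(1 <= j < m.+1)
      (D1 0 j.-1 U3 - D1 0 j.-1 U1) * ((bernS j).[s] / j`!%:R)
  + \sum_(1 <= i < m.+1) \sum_(1 <= j < (m - i + 1).+1)
      ((-1) ^+ (i + j) * (D2 j.-1 i.-1 U2 - D2 j.-1 i.-1 U1)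
       + (-1) ^+ j * (D3 j.-1 i.-1 U3 - D3 j.-1 i.-1 U1))
      * (bernSS i j (lambda2 x) s / (i`!%:R * j`!%:R)).

End Taylor.

Section Shepard.
Context {R : realType} {N : nat}.
Variables (V : 'I_N -> 'rV[R]_2) (Rw : 'I_N -> R).

(* Real power with 0 `^ mu = 0 for mu != 0.  Since 0^-1 = 0, the value at V i
   is meaningless; [nweight] does not use it. *)
Definition weight (mu : R) (i : 'I_N) (x : 'rV[R]_2) : R :=
  (Num.max ((enorm (x - V i))^-1 - (Rw i)^-1) 0) `^ mu.

Definition nweight (mu : R) (i : 'I_N) (x : 'rV[R]_2) : R :=
  if [pick k | x == V k] is Some k then (i == k)%:R
  else weight mu i x / \sum_(k < N) weight mu k x.

Lemma nweight_node (mu : R) (i k : 'I_N) : injective V ->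
  nweight mu i (V k) = (i == k)%:R.
Proof.
move=> Vinj; rewrite /nweight; case: pickP => [l /eqP/Vinj <-//|/(_ k)].
by rewrite eqxx.
Qed.

Definition admissible (i j k : 'I_N) : Prop :=
  nondegenerate (V i) (V j) (V k) /\
  triangle (V i) (V j) (V k) `<=` eball (V i) (Rw i).

(* (V i, V j, V k) is, among the cheapest admissible triangles at V i, the one
   that comes first in the enumeration [rank] of the ordered triples. *)
Definition associated_triangle (rank : 'I_N * 'I_N * 'I_N -> nat)
    (i j k : 'I_N) : Prop :=
  let cost j k := triangle_cost (V i) (V j) (V k) in
  admissible i j k /\
  forall j' k', admissible i j' k' ->
    cost j k < cost j' k' \/
    cost j k = cost j' k' /\ (rank (i, j, k) <= rank (i, j', k'))%N.

Definition shepard_bernoulli (m : nat) (mu : R) (j k : 'I_N -> 'I_N)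
    (f : 'rV[R]_2 -> R) (x : 'rV[R]_2) : R :=
  \sum_(i < N) nweight mu i x * gen_taylor m (V i) (V (j i)) (V (k i)) f x.

End Shepard.

Definition bipoly_fun {R : realType} (p : mpoly.mpoly 2 R) (x : 'rV[R]_2) : R :=
  mpoly.meval (x 0) p.

(* Main.v *)
Require Import Defs.
From HB Require Import structures.
From mathcomp Require Import all_boot all_order all_algebra.
From mathcomp Require Import -(notations) mpoly.
From mathcomp Require Import all_classical all_reals all_analysis.
From mathcomp Require Import ring.

Import Order.TTheory GRing.Theory Num.Theory.
Import numFieldNormedType.Exports.
Local Open Scope classical_set_scope.
Local Open Scope ring_scope.

(** The normalized weights are a partition of unity on [D], so the operator
reproduces every function that each local polynomial [gen_taylor] reproduces.
It remains to see that on one nondegenerate triangle [gen_taylor] of order [m]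
is the identity on polynomials of total degree at most [m].

In one variable, a polynomial [q] of degree at most [m] satisfies
  q(t) = q(0) + sum_(1 <= j <= m) (q^(j-1)(1) - q^(j-1)(0)) / j! * S_j(t)
([bernoulli_expansion]): up to the constant q(0) this is the expansion of [q']
in Bernoulli polynomials, whose coefficients are forced because differentiation
shifts the Bernoulli basis and all but the first of its members have mean 0.

Write s = lambda2 + lambda3 and t = lambda2, so that
  x = U1 + s (U3 - U1) + t (U2 - U3).
For s != 0 the point [x] lies on the chord from a = U1 + s (U3 - U1) to
b = U1 + s (U2 - U1), which is parallel to the side [U2 U3], at parameter t/s.
Expand [p] along this chord.  The value p(a) is then expanded along the side
[U1 U3], which gives the single sum of the operator.  The differences of
(i-1)-th derivatives at [b] and [a] are expanded along the sides [U1 U2] and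
[U1 U3]; these derivatives have degree at most m - i + 1, hence the range of [j]
in the double sum, and their two values at [U1] cancel.
The powers s^(i-1) come from the ratio s of the chord to the side [U2 U3], and
the signs from the orientation of the sides in [D2] and [D3].

At s = 0 the chord collapses, but for fixed [t] both sides are polynomials in
[s], so their equality for s != 0 gives it everywhere. *)

(** * Restriction of bivariate polynomials to lines *)

Section LineRestriction.
Context {R : realType}.
Implicit Types (p : mpoly 2 R) (a v : 'rV[R]_2).

(** Parametrizing by a formal variable reduces calculus in the plane to formal
calculus in [{poly R}]. *)
Definition line p a v : {poly R} :=
  mmap (@polyC R) (fun i => (a 0 i)%:P + v 0 i *: 'X) p.

Definition dirderiv v p : mpoly 2 R := \sum_(i < 2) v 0 i *: mderiv i p.

Lemma horner_line p a v (t : R) : (line p a v).[t] = bipoly_fun p (a + t *: v).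
Proof.
rewrite /line /bipoly_fun mevalE /mmap horner_sum; apply: eq_bigr => m _.
rewrite hornerM hornerC /mmap1 horner_prod; congr (_ * _).
apply: eq_bigr => i _.
by rewrite horner_exp !hornerE !mxE [v 0 i * t]mulrC.
Qed.

Lemma lineZ (c : R) p a v : line (c *: p) a v = c *: line p a v.
Proof. by rewrite /line mmapZ mul_polyC. Qed.

(** Chain rule.  By linearity only monomials matter, and on the two factors of a
monomial it is Leibniz's rule. *)
Lemma deriv_line p a v : (line p a v)^`() = line (dirderiv v p) a v.
Proof.
elim/mpolyind: p => [|c m p _ _ IHp]; rewrite /dirderiv.
  by rewrite big1 ?/line ?mmap0 ?deriv0 // => i _; rewrite mderiv0 scaler0.
under eq_bigr do rewrite mderivD scalerDr.
rewrite big_split {1 2}/line /= !mmapD derivD [X in _ + X]IHp; congr (_ + _).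
rewrite -!/(line _ a v) lineZ derivZ !big_ord_recl big_ord0 addr0.
rewrite {2}/line mmapD -!/(line _ a v) !lineZ !mderivZ !lineZ !mderivX !lineZ.
rewrite /line !mmapX /mmap1 !big_ord_recl !big_ord0 !mulr1 !mnmBE !mnm1E /=.
rewrite !subn0 !subn1.
have dl i : ((a 0 i)%:P + v 0 i *: 'X)^`() = (v 0 i)%:P.
  by rewrite derivD derivC add0r derivZ derivX -mul_polyC mulr1.
rewrite derivM !deriv_exp !dl !scaler_nat !mul_polyC.
rewrite scalerDr mulrnAl mulrnAr -scalerAl -scalerAr !scalerMnr !scalerA.
by rewrite ![c * _]mulrC.
Qed.

Lemma size_line p a v : (size (line p a v) <= msize p)%N.
Proof.
rewrite /line /mmap; apply/(leq_trans (size_sum _ _ _)).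
apply/bigmax_leqP_seq => m /msize_mdeg_lt; set d := msize p => mp _.
apply: leq_trans mp.
rewrite mul_polyC (leq_trans (size_scale_leq _ _))//.
rewrite /mmap1 mdegE !big_ord_recl !big_ord0 mulr1 addn0.
have sl i e : (size (((a 0 i)%:P + v 0 i *: 'X) ^+ e)%R <= e.+1)%N.
  apply: leq_trans (size_poly_exp_leq _ _) _; rewrite ltnS.
  rewrite -[leqRHS]mul1n leq_mul2r; apply/orP; right.
  rewrite -subn1 leq_subLR (leq_trans (size_polyD _ _))// geq_max.
  rewrite (leq_trans (size_polyC_leq1 _))//.
  by rewrite (leq_trans (size_scale_leq _ _))// size_polyX.
rewrite (leq_trans (size_polyMleq _ _))//.
by rewrite -subn1 leq_subLR add1n -addSn -addnS leq_add.
Qed.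

Lemma msize_mderiv i p : (msize (mderiv i p) <= (msize p).-1)%N.
Proof.
rewrite msizeE; apply/bigmax_leqP_seq => m + _.
rewrite mcoeff_msupp mcoeff_deriv => nz.
have : mnm_add m (mnm1 i) \in msupp p.
  by rewrite mcoeff_msupp; apply: contraNneq nz => ->; rewrite mul0rn.
by move=> /msize_mdeg_lt; rewrite mdegD mdeg1 addn1; case: (msize p).
Qed.

Lemma msize_dirderiv v p : (msize (dirderiv v p) <= (msize p).-1)%N.
Proof.
apply: leq_trans (msize_sum _ _ _) _; apply/bigmax_leqP => i _.
exact: leq_trans (msizeZ_le _ _) (msize_mderiv _ _).
Qed.

(** The difference quotients of [p] at [a] along [v] are those at 0 of the
univariate polynomial [line p a v], so no multivariate analysis is needed. *)
Lemma derive_bipoly_fun p a v :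
  'D_v (bipoly_fun p) a = bipoly_fun (dirderiv v p) a.
Proof.
have E : (fun h : R => h^-1 *: ((bipoly_fun p \o shift a) (h *: v)
    - bipoly_fun p a)) = (fun h => h^-1 *: ((horner (line p a v) \o shift 0)
    (h *: 1) - (line p a v).[0])).
  apply/funext => h /=.
  by rewrite !horner_line addr0 [h *: 1]mulr1 scale0r addr0 [a + _]addrC.
rewrite /derive E -/(derive _ _ _).
by rewrite derive_val deriv_line horner_line scale0r addr0.
Qed.

Lemma Dseg_bipoly_fun p (P Q : 'rV[R]_2) :
  Dseg P Q (bipoly_fun p) = bipoly_fun (dirderiv (P - Q) p).
Proof.
apply/funext => x; rewrite /Dseg /dot /bipoly_fun /dirderiv raddf_sum.
apply: eq_bigr => i _; rewrite !mxE /= mevalZ derive_bipoly_fun.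
congr (_ * _); rewrite /dirderiv (bigD1 i)//= big1 ?addr0.
  by rewrite mxE !eqxx scale1r.
by move=> k ki; rewrite mxE eqxx (negbTE ki) scale0r.
Qed.

End LineRestriction.

(** * Bernoulli expansion of univariate polynomials *)

Section BernoulliExpansion.
Context {R : realType}.
Implicit Types p q : {poly R}.

Lemma deriv_eq0_const p : p^`() = 0 -> p = p.[0]%:P.
Proof.
move=> p'0; apply/polyP => -[|i]; rewrite coefC ?horner_coef0//=.
have /eqP := congr1 (fun q : {poly R} => q`_i) p'0.
by rewrite coef_deriv coef0 mulrn_eq0 => /orP[//|/eqP].
Qed.

Lemma antideriv_is_linear : linear (@antideriv R).
Proof.
move=> c p q; apply/polyP => i.
by rewrite !(coefD, coefZ, coef_antideriv) mulrDl mulrA.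
Qed.

HB.instance Definition _ :=
  GRing.isLinear.Build R {poly R} {poly R} _ _ antideriv_is_linear.

(** The fundamental theorem of calculus: [(antideriv p).[1]] is the mean of [p]
over the unit interval. *)
Lemma antideriv1_deriv p : (antideriv p^`()).[1] = p.[1] - p.[0].
Proof.
have : (antideriv p^`() - p)^`() = 0 by rewrite derivB antiderivK subrr.
move=> /deriv_eq0_const/(congr1 (horner^~ 1)).
rewrite hornerC !hornerD !hornerN antideriv_horner0 sub0r => /eqP.
by rewrite subr_eq addrC => /eqP.
Qed.

Lemma antideriv1_bernpoly n : (antideriv (@bernpoly R n)).[1] = (n == 0%N)%:R.
Proof.
case: n => [|n] /=; last by rewrite antiderivBC !hornerE subrr.
have <- : ('X : {poly R})^`() = 1 by rewrite derivX.
by rewrite antideriv1_deriv !hornerX subr0.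
Qed.

(** By induction on the degree: the derivative of the right-hand side is the
expansion of [q''], so the two sides differ by a constant.  That constant is 0
since both sides have mean [q.[1] - q.[0]]: only [bernpoly 0] has a nonzero
mean. *)
Lemma deriv_bernoulli_expansion m q : (size q <= m.+1)%N ->
  q^`() = \sum_(j < m)
    ((q^`(j)).[1] - (q^`(j)).[0]) / j`!%:R *: bernpoly j.
Proof.
elim: m q => [|m IHm] q sq; first by rewrite big_ord0 -derivn1 derivn_poly0.
apply/eqP; rewrite -subr_eq0; apply/eqP; set e := _ - _.
have e'0 : e^`() = 0.
  rewrite /e derivB (IHm q^`()); last first.
    by rewrite (leq_trans (size_poly _ _))// -subn1 leq_subLR.
  rewrite big_ord_recl linearD linearZ /= -polyC1 derivC scaler0 add0r.
  rewrite linear_sum; apply/eqP; rewrite subr_eq0; apply/eqP.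
  apply: eq_bigr => j _; rewrite linearZ /= -/(bernpoly j.+1) deriv_bernpoly.
  rewrite scalerA -!derivSn; congr (_ *: _).
  by rewrite factS natrM invfM mulrA mulrAC mulfVK ?pnatr_eq0//.
have : (antideriv e).[1] = 0.
  rewrite /e linearB hornerD hornerN antideriv1_deriv linear_sum horner_sum.
  rewrite big_ord_recl big1 => [|i _]; last first.
    by rewrite linearZ hornerZ antideriv1_bernpoly mulr0.
  rewrite linearZ hornerZ antideriv1_bernpoly mulr1 fact0 divr1 addr0.
  by rewrite subrr.
rewrite (deriv_eq0_const _ e'0).
(* A constant is the derivative of a linear polynomial, whence its mean. *)
rewrite -[_%:P](_ : (e.[0] *: 'X)^`() = _); last first.
  by rewrite derivZ derivX alg_polyC.
by rewrite antideriv1_deriv !hornerZ !hornerX mulr0 subr0 mulr1 => ->;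
  rewrite scale0r deriv0.
Qed.

(** Both sides agree at 0, where every [bernS j] vanishes, and have the same
derivative. *)
Lemma bernoulli_expansion m q : (size q <= m.+1)%N ->
  q = q.[0]%:P + \sum_(1 <= j < m.+1)
    ((q^`(j.-1)).[1] - (q^`(j.-1)).[0]) / j`!%:R *: bernS j.
Proof.
move=> sq; apply/eqP; rewrite -subr_eq0; apply/eqP; set e := _ - _.
suff /deriv_eq0_const -> : e^`() = 0.
  rewrite /e hornerD hornerN hornerD hornerC horner_sum big1 ?addr0 ?subrr//.
  by move=> j _; rewrite hornerZ /bernS !hornerE subrr mulr0.
rewrite /e derivB derivD derivC add0r (deriv_bernoulli_expansion _ _ sq).
rewrite linear_sum big_add1 big_mkord -sumrB big1// => j _.
rewrite linearZ /= /bernS derivB derivC subr0 deriv_bernpoly scalerA.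
rewrite -scalerBl factS natrM -[RHS](scale0r (bernpoly j)); congr (_ *: _).
by rewrite invfM mulrA [_ * _%:R]mulrAC mulfVK ?pnatr_eq0// subrr.
Qed.

End BernoulliExpansion.

(** * Iterated directional derivatives and expansion along segments *)

Section DirectionalDerivatives.
Context {R : realType}.
Implicit Types (p : mpoly 2 R) (a v : 'rV[R]_2).

Lemma dirderivZr v (c : R) p : dirderiv v (c *: p) = c *: dirderiv v p.
Proof.
rewrite /dirderiv scaler_sumr; apply: eq_bigr => i _.
by rewrite mderivZ !scalerA mulrC.
Qed.

Lemma iter_dirderivZ n (c : R) v p :
  iter n (dirderiv (c *: v)) p = c ^+ n *: iter n (dirderiv v) p.
Proof.
elim: n => [|n IHn] /=; first by rewrite scale1r.
rewrite IHn dirderivZr {1}/dirderiv.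
under eq_bigr do rewrite mxE -scalerA.
by rewrite -scaler_sumr scalerA exprSr.
Qed.

Lemma iter_dirderivZr n v (c : R) p :
  iter n (dirderiv v) (c *: p) = c *: iter n (dirderiv v) p.
Proof. by elim: n => //= n ->; rewrite dirderivZr. Qed.

Lemma iter_dirderivN n v p :
  iter n (dirderiv (- v)) p = (-1) ^+ n *: iter n (dirderiv v) p.
Proof. by rewrite -scaleN1r iter_dirderivZ. Qed.

Lemma msize_iter_dirderiv n v p :
  (msize (iter n (dirderiv v) p) <= msize p - n)%N.
Proof.
elim: n => [|n IHn] /=; first by rewrite subn0.
by rewrite (leq_trans (msize_dirderiv _ _))// subnS -!subn1 leq_sub2r.
Qed.

Lemma derivn_line n p a v :
  (line p a v)^`(n) = line (iter n (dirderiv v) p) a v.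
Proof. by elim: n => //= n ->; rewrite deriv_line. Qed.

Lemma bipoly_funZ (c : R) p a : bipoly_fun (c *: p) a = c * bipoly_fun p a.
Proof. exact: mevalZ. Qed.

Lemma iter_Dseg_bipoly_fun n (P Q : 'rV[R]_2) p :
  iter n (Dseg P Q) (bipoly_fun p) = bipoly_fun (iter n (dirderiv (P - Q)) p).
Proof. by elim: n => //= n ->; rewrite Dseg_bipoly_fun. Qed.

Lemma bernoulli_expansion_line m p a b (t : R) : (msize p <= m.+1)%N ->
  bipoly_fun p (a + t *: (b - a)) = bipoly_fun p a + \sum_(1 <= j < m.+1)
    (bipoly_fun (iter j.-1 (dirderiv (b - a)) p) b -
     bipoly_fun (iter j.-1 (dirderiv (b - a)) p) a) / j`!%:R * (bernS j).[t].
Proof.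
move=> pm; rewrite -horner_line.
rewrite (@bernoulli_expansion _ m (line p a (b - a))); last first.
  exact: leq_trans (size_line _ _ _) pm.
rewrite hornerD hornerC horner_line scale0r addr0 horner_sum; congr (_ + _).
apply: eq_bigr => j _; rewrite hornerZ derivn_line !horner_line.
by rewrite scale0r addr0 scale1r [a + _]addrC subrK.
Qed.

End DirectionalDerivatives.

(** * Exactness of the generalized Taylor polynomial *)

Section GeneralizedTaylor.
Context {R : realType}.
Implicit Types p : mpoly 2 R.

(** Subtracting the first column from the others: a 2 x 2 determinant of edge
vectors. *)
Lemma detAE (P Q S : 'rV[R]_2) : detA P Q S =
  (Q 0 0 - P 0 0) * (S 0 1 - P 0 1) - (S 0 0 - P 0 0) * (Q 0 1 - P 0 1).
Proof.
rewrite /detA; set M := row_mx _ _.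
have ME (r c : 'I_3) : M r c =
    nth 0 (nth [::] [:: [:: 1; 1; 1]; [:: P 0 0; Q 0 0; S 0 0];
                        [:: P 0 1; Q 0 1; S 0 1]] r) c.
  rewrite /M; case: c => -[|[|[|//]]] c3; case: r => -[|[|[|//]]] r3;
  rewrite !mxE; do ?[case: splitP => // -[[|[|//]] ?] // _; rewrite ?mxE] => //;
  by [congr (P _ _); exact/val_inj | congr (Q _ _); exact/val_inj
     | congr (S _ _); exact/val_inj].
clearbody M; rewrite (expand_det_row _ ord0) !big_ord_recl big_ord0 /cofactor.
rewrite !(expand_det_row _ ord0) !big_ord_recl !big_ord0 /cofactor !det_mx11.
rewrite !mxE !ME /= /bump /=; ring.
Qed.

(** Cramer's rule. *)
Lemma barycentric (U1 U2 U3 x : 'rV[R]_2) : Defs.nondegenerate U1 U2 U3 ->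
  x = U1 + lambda2 U1 U2 U3 x *: (U2 - U1) + lambda3 U1 U2 U3 x *: (U3 - U1).
Proof.
rewrite /Defs.nondegenerate /lambda2 /lambda3 !detAE => nd.
apply/rowP => i; rewrite !mxE.
have : i = 0 \/ i = 1 by case: i => -[|[|//]] i2; [left|right]; exact/val_inj.
by move=> [] ->; field.
Qed.

Definition bernSS_poly (i j : nat) (t : R) : {poly R} :=
  (\sum_(k < i.+1) ((bernS i)`_k * t ^+ k) *: 'X^(i - k))
  * drop_poly 1 (bernS j).

Lemma horner_bernSS_poly i j (t s : R) :
  (bernSS_poly i j t).[s] = bernSS i j t s.
Proof.
rewrite hornerM horner_sum; congr (_ * _); apply: eq_bigr => k _.
by rewrite hornerZ hornerXn.
Qed.

(** For fixed [t], the generalized Taylor polynomial as a polynomial in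
[s = lambda2 + lambda3]; this lets the degenerate value [s = 0] be reached from
the others. *)
Definition taylor_poly m (U1 U2 U3 : 'rV[R]_2) (f : 'rV[R]_2 -> R) (t : R) :
    {poly R} :=
  (f U1)%:P
  + \sum_(1 <= j < m.+1)
      ((D1 U1 U2 U3 f 0 j.-1 U3 - D1 U1 U2 U3 f 0 j.-1 U1) / j`!%:R) *: bernS j
  + \sum_(1 <= i < m.+1) \sum_(1 <= j < (m - i + 1).+1)
      (((-1) ^+ (i + j)
          * (D2 U1 U2 U3 f j.-1 i.-1 U2 - D2 U1 U2 U3 f j.-1 i.-1 U1)
        + (-1) ^+ j
          * (D3 U1 U2 U3 f j.-1 i.-1 U3 - D3 U1 U2 U3 f j.-1 i.-1 U1))
       / (i`!%:R * j`!%:R)) *: bernSS_poly i j t.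

Lemma gen_taylorE m (U1 U2 U3 : 'rV[R]_2) (f : 'rV[R]_2 -> R) (x : 'rV[R]_2) :
  gen_taylor m U1 U2 U3 f x =
  (taylor_poly m U1 U2 U3 f (lambda2 U1 U2 U3 x)).[
    lambda2 U1 U2 U3 x + lambda3 U1 U2 U3 x].
Proof.
rewrite !hornerD hornerC !horner_sum; congr (_ + _ + _); apply: eq_bigr => i _.
  by rewrite hornerZ mulrA mulrAC.
rewrite horner_sum; apply: eq_bigr => j _.
by rewrite hornerZ horner_bernSS_poly mulrA mulrAC.
Qed.

(** The core computation: expansion along the chord from [a] to [b], parallel to
the side [U2 U3], followed by expansions of its end-point data along the sides
through [U1]. *)
Lemma horner_taylor_poly_neq0 m (U1 U2 U3 : 'rV[R]_2) p (t s : R) :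
  (msize p <= m.+1)%N -> s != 0 ->
  (taylor_poly m U1 U2 U3 (bipoly_fun p) t).[s] =
  bipoly_fun p (U1 + s *: (U3 - U1) + t *: (U2 - U3)).
Proof.
move=> pm s0; set a := U1 + s *: (U3 - U1); set b := U1 + s *: (U2 - U1).
have ba : b - a = s *: (U2 - U3).
  rewrite /a /b opprD addrACA subrr add0r -scalerBr opprB addrA subrK //.
have -> : t *: (U2 - U3) = (t / s) *: (b - a) by rewrite ba scalerA divfK.
rewrite (bernoulli_expansion_line _ _ _ _ _ pm) ba.
(* The value at [a] gives the single sum, as [a] is on the side U1 U3. *)
rewrite /a (bernoulli_expansion_line _ _ _ _ _ pm) /taylor_poly.
rewrite !hornerD hornerC !horner_sum.
congr (_ + _ + _).
  by apply: eq_bigr => j _; rewrite hornerZ /D1 /= iter_Dseg_bipoly_fun.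
rewrite -/a; apply: eq_big_nat => i /andP[i0 im].
rewrite horner_sum !iter_dirderivZ !bipoly_funZ -mulrBr.
set w := U2 - U3; set q := iter _ _ _.
have qm : (msize q <= (m - i + 1).+1)%N.
  have -> : ((m - i + 1).+1 = m.+1 - i.-1)%N.
    by case: i {q} i0 im => // i _ im; rewrite addn1 subnSK // subSn // ltnW.
  by rewrite (leq_trans (msize_iter_dirderiv _ _ _))// leq_sub2r.
(* At the ends of the chord, along the two sides through U1: the values of [q]
   at U1 cancel. *)
rewrite /a /b !(bernoulli_expansion_line _ _ _ _ _ qm).
rewrite opprD addrACA subrr add0r.
rewrite -sumrB mulr_sumr !mulr_suml; apply: eq_big_nat => j /andP[j0 jm].
rewrite hornerZ horner_bernSS_poly /D2 /D3 !iter_Dseg_bipoly_fun.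
rewrite -(opprB U2 U1) -(opprB U2 U3) -(opprB U3 U1) !iter_dirderivN.
rewrite iter_dirderivZr !bipoly_funZ -!mulrBr -/q bernSSE//.
(* [D2] runs along U2 U1 and U2 U3 away from U2, and [D3] along U3 U1 away from
   U3, opposite to the directions used here; the signs of the operator undo
   this. *)
have sgn2 (X : R) : (-1) ^+ (i + j) * ((-1) ^+ j.-1 * ((-1) ^+ i.-1 * X)) = X.
  rewrite !mulrA -!exprD -signr_odd !oddD.
  by case: i j i0 j0 {im jm q qm} => [|i] [|j] //= _ _;
    case: (odd i); case: (odd j); rewrite /= ?mul1r.
have sgn1 (X : R) : (-1) ^+ j * ((-1) ^+ j.-1 * X) = - X.
  by rewrite -{1}(prednK j0) exprS -mulrA [X in -1 * X]mulrA -expr2 sqrr_sign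
    mul1r mulN1r.
rewrite sgn2 sgn1 mulrDl mulNr; field; rewrite !pnatr_eq0 -!lt0n !fact_gt0//.
Qed.

Lemma poly_eq_off0 (p q : {poly R}) :
  (forall s, s != 0 -> p.[s] = q.[s]) -> p = q.
Proof.
move=> pq; apply/eqP; rewrite -subr_eq0; apply/eqP.
pose rs := [seq n.+1%:R | n <- iota 0 (size (p - q))] : seq R.
apply: (@roots_geq_poly_eq0 _ _ rs); last by rewrite size_map size_iota.
  apply/allP => _ /mapP[n _ ->].
  by rewrite /root hornerD hornerN pq ?pnatr_eq0// subrr.
rewrite /rs map_inj_uniq ?iota_uniq// => a b /eqP.
by rewrite eqr_nat => /eqP[].
Qed.

(** Both sides are polynomials in [s] for fixed [t], so the case [s != 0]
suffices. *)
Lemma gen_taylor_bipoly_fun m (U1 U2 U3 : 'rV[R]_2) p x :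
  Defs.nondegenerate U1 U2 U3 ->
  (msize p <= m.+1)%N ->
  gen_taylor m U1 U2 U3 (bipoly_fun p) x = bipoly_fun p x.
Proof.
move=> nd pm; set t := lambda2 U1 U2 U3 x; set s := t + lambda3 U1 U2 U3 x.
have xE : x = U1 + t *: (U2 - U3) + s *: (U3 - U1).
  rewrite {1}(barycentric _ _ _ x nd) -/t /s scalerDl.
  rewrite -!addrA; congr (_ + _); rewrite addrA; congr (_ + _).
  by rewrite -scalerDr addrA subrK.
rewrite [in RHS]xE -horner_line.
rewrite gen_taylorE -/t -/s; congr horner; apply: poly_eq_off0 => u u0.
by rewrite horner_taylor_poly_neq0// horner_line addrAC.
Qed.

End GeneralizedTaylor.

(** * Partition of unity *)

Section Weights.
Context {R : realType}.

Lemma enorm_gt0 (u : 'rV[R]_2) : u != 0 -> 0 < enorm u.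
Proof.
move=> u0; rewrite /enorm sqrtr_gt0 lt_neqAle eq_sym sumr_ge0 ?andbT;
  last by move=> i _; rewrite -expr2 sqr_ge0.
apply: contra u0; rewrite psumr_eq0 => [/allP u0|i _]; last first.
  by rewrite -expr2 sqr_ge0.
apply/eqP/rowP => i; have := u0 i (mem_index_enum i).
by rewrite mxE -expr2 sqrf_eq0 => /eqP.
Qed.

Lemma weight_gt0 N (V : 'I_N -> 'rV[R]_2) (Rw : 'I_N -> R) (mu : R) i x :
  x != V i -> eball (V i) (Rw i) x -> 0 < weight V Rw mu i x.
Proof.
rewrite -subr_eq0 => /enorm_gt0 d0 dR; rewrite powR_gt0// lt_max subr_gt0.
by rewrite ltf_pV2 ?posrE ?dR// (lt_trans d0 dR).
Qed.

(** At a node the weights are a Kronecker delta.  Elsewhere the normalization is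
a genuine division, as some ball contains [x] and its weight is positive. *)
Lemma sum_nweight N (V : 'I_N -> 'rV[R]_2) (Rw : 'I_N -> R) (mu : R) x :
  (exists i, eball (V i) (Rw i) x) ->
  \sum_(i < N) nweight V Rw mu i x = 1.
Proof.
move=> [l xl]; rewrite /nweight; case: pickP => [k _|nV].
  by rewrite (bigD1 k)//= eqxx big1 ?addr0// => i /negbTE ->.
rewrite -mulr_suml divff// gt_eqF// (bigD1 l)//= ltr_wpDr//.
  by apply: sumr_ge0 => i _; exact: powR_ge0.
by apply: weight_gt0 => //; rewrite nV.
Qed.

End Weights.

(** * Degree of exactness of the Shepard-Bernoulli operator *)

Theorem theorem3p3 (R : realType) (m : nat) (mu : R) (D : set 'rV[R]_2)
  (N : nat) (V : 'I_N -> 'rV[R]_2) (Rw : 'I_N -> R)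
  (rank : 'I_N * 'I_N * 'I_N -> nat) (j k : 'I_N -> 'I_N)
  (m_ge1 : (1 <= m)%N)
  (mu_gt0 : 0 < mu)
  (D_compact : compact D)
  (D_convex : convex_set D)
  (D_interior : interior D !=set0)
  (V_in_D : forall i, D (V i))
  (V_inj : injective V)
  (Rw_gt0 : forall i, 0 < Rw i)
  (D_cover : D `<=` \bigcup_i eball (V i) (Rw i))
  (rank_inj : injective rank)
  (jkP : forall i, associated_triangle V Rw rank i (j i) (k i)) :
  forall p : mpoly.mpoly 2 R, (mpoly.msize p <= m.+1)%N ->
  forall x, D x ->
    shepard_bernoulli V Rw m mu j k (bipoly_fun p) x = bipoly_fun p x.
Proof.
move=> p pm x Dx; rewrite /shepard_bernoulli.
under eq_bigr => i _.
  have [[nd _] _] := jkP i.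
  rewrite gen_taylor_bipoly_fun//.
  over.
rewrite -mulr_suml sum_nweight ?mul1r//.
by have [i _ xi] := D_cover _ Dx; exists i.
Qed.
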